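(* Let $n \ge 1$ and let $f_1,\dots,f_n\in L^1([0,1])$ be real-valued. Then there exists a real-valued function $g\in C_c^{\infty}((0,1))$ such that $$\int_0^1 f_j(x)\,e^{ig(x)}\,dx=0\qquad\text{for all } 1\le j\le n.$$
   Context: $L^1([0,1])$ is the space of Lebesgue-integrable functions on $[0,1]$. $C_c^\infty((0,1))$ denotes the infinitely differentiable functions with compact support contained in the open interval $(0,1)$, extended by $0$ to $[0,1]$. *)

(* Defs.v *)
From mathcomp Require Import all_boot all_order all_algebra.
From mathcomp Require Import complex.
From mathcomp Require Import all_classical all_reals all_analysis.

Set Implicit Arguments.
Unset Strict Implicit.
Unset Printing Implicit Defensive.

Import Order.TTheory GRing.Theory Num.Theory.
Import numFieldNormedType.Exports.

Local Open Scope classical_set_scope.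
Local Open Scope ring_scope.

Definition expC {R : realType} (z : R[i]) : R[i] :=
  (expR (complex.Re z))%:C%C *
  (cos (complex.Im z) +i* sin (complex.Im z))%C.

(* Componentwise integral; [Rintegral] has junk values outside the integrable
   functions, so it is only meaningful when both components are integrable. *)
Definition Cintegral (d : measure_display) (T : measurableType d) (R : realType)
    (mu : {measure set T -> \bar R}) (D : set T) (F : T -> R[i]) : R[i] :=
  (Rintegral mu D (fun x => complex.Re (F x))
   +i* Rintegral mu D (fun x => complex.Im (F x)))%C.

Definition tsupport {R : realType} (g : R -> R) : set R :=
  closure [set x | g x != 0].

Definition smooth {R : realType} (g : R -> R) : Prop :=
  forall (k : nat) (x : R), derivable (derive1n k g) x 1.

(* An element of C_c^oo(U), for U open, is represented by its extension by 0
   to the whole line. *)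
Definition smooth_compact_support {R : realType} (U : set R) (g : R -> R) :
    Prop :=
  [/\ smooth g, compact (tsupport g) & tsupport g `<=` U].

(* Integrability for the completed measure: f is Lebesgue measurable, and not
   necessarily Borel measurable; values outside [0, 1] are irrelevant. *)
Definition L1_01 {R : realType} (f : R -> R) : Prop :=
  (@completed_lebesgue_measure R).-integrable `[0%R, 1%R] (EFin \o f).

(* Main.v *)
(* For a large integer N let theta be a test function equal to 2 pi N x outside
   a thin layer near 0 and 1.  By the Riemann-Lebesgue lemma the integrals of
   the f_l, and of the products f_l phi_k with fixed test functions phi_k,
   against cos and sin of theta and of 2 theta are all small.  Suppose that the
   phi_k are dual to the f_l, i.e. int f_l phi_k = delta_lk, and perturb the
   phase to
     g = theta + sum_k (a_k cos theta + b_k sin theta) phi_k.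
   Since 2 cos^2 = 1 + cos (2 theta), 2 sin^2 = 1 - cos (2 theta) and
   2 sin cos = sin (2 theta), the map
     (a, b) |-> (2 int f_l sin g, - 2 int f_l cos g)_l
   is small at 0 and close to the identity in the Lipschitz sense on a ball
   whose radius does not depend on N; the contraction principle gives a zero.
   In general the moment vectors (int f_j phi)_j of the test functions phi span
   a subspace of R^n, which also contains the moment vectors of cos g and
   sin g; coordinates in a basis of that subspace reduce to the dual case. *)
Require Import Defs.
From HB Require Import structures.
From mathcomp Require Import all_boot all_order all_algebra.
From mathcomp Require Import complex.
From mathcomp Require Import all_classical all_reals all_analysis.
From mathcomp Require Import measurable_realfun.
From mathcomp Require Import ring lra.
Set Implicit Arguments.
Unset Strict Implicit.
Unset Printing Implicit Defensive.

Import Order.TTheory GRing.Theory Num.Theory.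
Import numFieldNormedType.Exports.
Local Open Scope classical_set_scope.
Local Open Scope ring_scope.

(** * Smooth functions *)

Section smooth_functions.
Context {R : realType}.
Implicit Types (u v g : R -> R).

(** Differentiability of a finite order makes induction possible: the product, chain and quotient
    rules express a derivative through functions that are known to be smooth only to one order
    less. *)
Definition derivablen (n : nat) g :=
  forall k, (k < n)%N -> forall x, derivable (derive1n k g) x 1.

Lemma smooth_derivablen g : smooth g <-> forall n, derivablen n g.
Proof.
split=> [sg n k _|sg k]; first exact: sg.
exact: (sg k.+1 k).
Qed.

Lemma derivablen0 g : derivablen 0 g.
Proof. by []. Qed.

Lemma derivablenS n g :
  derivablen n.+1 g <-> (forall x, derivable g x 1) /\ derivablen n (derive1 g).
Proof.
split=> [dg|[dg dg'] [|k] kn]; last 2 first.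
- exact: dg.
- by rewrite /derive1n iterSr; exact: dg'.
split=> [x|k kn x]; first exact: (dg 0).
by have := dg k.+1 kn x; rewrite /derive1n iterSr.
Qed.

Lemma derivablen_is_derive n g g' :
  (forall x : R, is_derive x 1 g (g' x)) -> derivablen n g' -> derivablen n.+1 g.
Proof.
move=> dg dg'; apply/derivablenS; split=> [x|].
  exact: (@ex_derive _ _ _ _ _ _ _ (dg x)).
suff -> : (derive1 g) = g' by [].
by apply/funext => x; rewrite derive1E; have := dg x => ?; rewrite derive_val.
Qed.

Lemma is_derive_derive1 g (x : R) :
  derivable g x 1 -> is_derive x 1 g (derive1 g x).
Proof. by move=> dg; rewrite derive1E; exact/derivableP. Qed.

Lemma derivablenW n g : derivablen n.+1 g -> derivablen n g.
Proof. by move=> dg k kn; apply: dg; exact: ltnW. Qed.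

Lemma smooth_derivable g : smooth g -> forall x, derivable g x 1.
Proof. by move=> sg; exact: (sg 0). Qed.

Lemma smooth_continuous g : smooth g -> continuous g.
Proof.
move=> sg x; apply: differentiable_continuous.
exact/derivable1_diffP/smooth_derivable.
Qed.

Lemma smooth_cst (c : R) : smooth (fun=> c).
Proof.
apply/smooth_derivablen => n; elim: n c => [c|n IH c]; first exact: derivablen0.
exact: (@derivablen_is_derive _ _ (fun=> 0)).
Qed.

Lemma smooth_id : smooth (fun x : R => x).
Proof.
apply/smooth_derivablen => -[//|n].
apply: (@derivablen_is_derive _ _ (fun=> 1)).
exact: ((smooth_derivablen _).1 (@smooth_cst 1)).
Qed.

Lemma derivablenD n u v :
  derivablen n u -> derivablen n v -> derivablen n (fun x => u x + v x).
Proof.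
elim: n u v => [*|n IH u v]; first exact: derivablen0.
move=> /derivablenS[du du'] /derivablenS[dv dv'].
apply: (@derivablen_is_derive n (fun x => u x + v x)
  (fun x => derive1 u x + derive1 v x)); last exact: IH.
by move=> x; apply: is_deriveD; exact: is_derive_derive1.
Qed.

Lemma derivablenM n u v :
  derivablen n u -> derivablen n v -> derivablen n (fun x => u x * v x).
Proof.
elim: n u v => [*|n IH u v]; first exact: derivablen0.
move=> du dv.
have /derivablenS[du1 du'] := du; have /derivablenS[dv1 dv'] := dv.
apply: (@derivablen_is_derive n (fun x => u x * v x)
  (fun x => u x * derive1 v x + v x * derive1 u x)).
  by move=> x; apply: is_deriveM; exact: is_derive_derive1.
apply: derivablenD; apply: IH.
- exact: derivablenW du.
- exact: dv'.
- exact: derivablenW dv.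
- exact: du'.
Qed.

Lemma derivablen_comp n u v :
  derivablen n u -> derivablen n v -> derivablen n (fun x => u (v x)).
Proof.
elim: n u v => [*|n IH u v]; first exact: derivablen0.
move=> du dv.
have /derivablenS[du1 du'] := du; have /derivablenS[dv1 dv'] := dv.
apply: (@derivablen_is_derive n (fun x => u (v x))
  (fun x => derive1 u (v x) * derive1 v x)).
  by move=> x; apply: is_derive1_comp; exact: is_derive_derive1.
apply: derivablenM; last exact: dv'.
by apply: IH; [exact: du'|exact: derivablenW dv].
Qed.

(** The derivative of 1/u is -(1/u)^2 u', so the induction closes on 1/u itself. *)
Lemma derivablenV n u :
  (forall x, u x != 0) -> derivablen n u -> derivablen n (fun x => (u x)^-1).
Proof.
move=> u0; elim: n => [_|n IH du]; first exact: derivablen0.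
 have /derivablenS[du1 du'] := du.
apply: (@derivablen_is_derive _ _
    (fun x => -1 * ((u x)^-1 * (u x)^-1) * derive1 u x)).
  move=> x; have -> : -1 * ((u x)^-1 * (u x)^-1) * derive1 u x
      = - (u x) ^- 2 *: derive1 u x.
    by rewrite mulN1r expr2 invfM.
  by apply: is_deriveV => //; exact: is_derive_derive1.
have {}IH := IH (derivablenW du).
apply: derivablenM; last exact: du'.
apply: derivablenM; last by apply: derivablenM; exact: IH.
exact: ((smooth_derivablen _).1 (@smooth_cst (-1))).
Qed.

Lemma smoothD u v : smooth u -> smooth v -> smooth (fun x => u x + v x).
Proof.
by move=> /smooth_derivablen su /smooth_derivablen sv;
  apply/smooth_derivablen => n; exact: derivablenD.
Qed.

Lemma smoothM u v : smooth u -> smooth v -> smooth (fun x => u x * v x).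
Proof.
by move=> /smooth_derivablen su /smooth_derivablen sv;
  apply/smooth_derivablen => n; exact: derivablenM.
Qed.

Lemma smooth_comp u v : smooth u -> smooth v -> smooth (fun x => u (v x)).
Proof.
by move=> /smooth_derivablen su /smooth_derivablen sv;
  apply/smooth_derivablen => n; exact: derivablen_comp.
Qed.

Lemma smoothV u :
  (forall x, u x != 0) -> smooth u -> smooth (fun x => (u x)^-1).
Proof.
by move=> u0 /smooth_derivablen su; apply/smooth_derivablen => n;
  exact: derivablenV.
Qed.

Lemma smooth_affine (a b : R) : smooth (fun x => a * x + b).
Proof.
by apply: smoothD; [apply: smoothM; [|exact: smooth_id]|]; exact: smooth_cst.
Qed.

(** The two are treated together because, up to sign, each is the derivative of the other. *)
Lemma smooth_cos_sin : smooth (@cos R) /\ smooth (@sin R).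
Proof.
suff H n : derivablen n (@cos R) /\ derivablen n (@sin R).
  by split; apply/smooth_derivablen => n; have [] := H n.
elim: n => [|n [dc ds]]; first by split; exact: derivablen0.
split.
- apply: (@derivablen_is_derive _ _ (fun x => -1 * sin x)).
    by move=> x; rewrite mulN1r; exact: is_derive_cos.
  apply: derivablenM; last exact: ds.
  exact: ((smooth_derivablen _).1 (@smooth_cst (-1))).
- by apply: (@derivablen_is_derive _ _ (@cos R)); last exact: dc.
Qed.

Definition smooth_cos := smooth_cos_sin.1.
Definition smooth_sin := smooth_cos_sin.2.

End smooth_functions.

(** * Flat functions and smooth steps *)

Section smooth_cutoffs.
Context {R : realType}.
Implicit Types (p : {poly R}) (x : R).

(** Each monomial satisfies y^i <= i! exp y, by comparison with one term of the exponential series;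
    the coefficients then add up to C. *)
Lemma horner_le_expR p :
  exists2 C : R, 0 <= C & forall y, 0 <= y -> `|p.[y]| <= C * expR y.
Proof.
have pow_le (y : R) i : 0 <= y -> y ^+ i <= i`!%:R * expR y.
  move=> y0; case: i => [|i].
    by rewrite expr0 fact0 mul1r -expR0 ler_expR.
  rewrite mulrC -ler_pdivrMr ?ltr0n ?fact_gt0//.
  by apply: le_trans (expR_ge1Dxn i y0); rewrite lerDr.
exists (\sum_(i < size p) `|p`_i| * i`!%:R).
  by apply: sumr_ge0 => i _; rewrite mulr_ge0.
move=> y y0; rewrite horner_coef mulr_suml.
apply: le_trans (ler_norm_sum _ _ _) _; apply: ler_sum => i _.
rewrite normrM -mulrA ler_wpM2l// ger0_norm ?exprn_ge0//; exact: pow_le.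
Qed.

(* The derivatives of [exp (-1/x)] (extended by [0]) all have this form. *)
Definition flat p x : R := if 0 < x then p.[x^-1] * expR (- x^-1) else 0.

(** With y = 1/x, the exponential bound for p X^2 reads |p(y)| y^2 <= C exp y, which is the claim
    after division by y^2 exp y. The order 2 of vanishing is what makes the derivative at 0 equal to
    0. *)
Lemma flat_le_sqr p :
  exists2 C : R, 0 <= C & forall x, `|flat p x| <= C * x ^+ 2.
Proof.
have [C C0 HC] := horner_le_expR (p * 'X^2).
exists C => // x; rewrite /flat; case: ifPn => x0; last first.
  by rewrite normr0 mulr_ge0 ?sqr_ge0.
have y0 : 0 <= x^-1 by rewrite invr_ge0 ltW.
have := HC _ y0; rewrite hornerM hornerXn normrM (ger0_norm (exprn_ge0 _ y0)).
rewrite exprVn ler_pdivrMr ?exprn_gt0// => H.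
rewrite normrM (ger0_norm (expR_ge0 _)) expRN ler_pdivrMr ?expR_gt0//.
by rewrite mulrAC.
Qed.

(** For y = 1/x one has dy/dx = -y^2, so p(y) exp(-y) has derivative y^2 (p - p')(y) exp(-y), again
    of the same form. Only x = 0 needs an estimate. *)
Lemma is_derive_flat p x :
  is_derive x 1 (flat p) (flat ('X^2 * (p - p^`())) x).
Proof.
have [x0|x0|x0] := ltgtP x 0.
- rewrite {2}/flat ltNge (ltW x0)/=.
  apply: (near_eq_is_derive (f:=fun=> 0)).
  near=> y; rewrite /flat ifF//; apply/negbTE; rewrite -leNgt ltW//.
  by near: y; exact: lt_nbhsl.
- rewrite {2}/flat x0.
  have x1 : x != 0 by rewrite gt_eqF.
  have dV : is_derive x 1 (fun y : R => y^-1) (- x ^- 2).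
    rewrite -[X in is_derive _ _ _ X]mulr1.
    exact: (is_deriveV x1 (is_derive_id _ _)).
  have dp := is_derive1_comp (is_derive_poly p x^-1) dV.
  have dN : is_derive x 1 (fun y : R => - y^-1) (- - x ^- 2) := is_deriveN dV.
  have dE := @is_derive1_comp R expR (fun y : R => - y^-1) x _ _
    (is_derive_expR (- x^-1)) dN.
  have d : is_derive x 1 (fun y : R => p.[y^-1] * expR (- y^-1))
      (('X^2 * (p - p^`())).[x^-1] * expR (- x^-1)).
    apply: (is_derive_eq (is_deriveM dp dE)).
    rewrite /GRing.scale/= hornerM hornerXn hornerD hornerN opprK exprVn.
    ring.
  apply: near_eq_is_derive d; near=> y; rewrite /flat ifT//.
  by near: y; exact: lt_nbhsr.
- rewrite {2}/flat x0 ltxx.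
  have [C C0 HC] := flat_le_sqr p.
  have flat0 : flat p 0 = 0 by rewrite /flat ltxx.
  have lim0 : h^-1 *: ((flat p \o shift (0 : R)) (h *: 1) - flat p 0)
      @[h --> (0 : R)^'] --> (0 : R).
    apply/cvgr0Pnorm_le => e e0.
    near=> h.
    have h0 : h != 0 by near: h; exact: nbhs_dnbhs_neq.
    rewrite flat0 subr0 /= addr0 /GRing.scale/= mulr1 normrM normfV.
    rewrite mulrC ler_pdivrMr ?normr_gt0//.
    apply: le_trans (HC _) _.
    rewrite -real_normK ?num_real// expr2 mulrA ler_wpM2r//.
    (* The difference quotient at 0 is at most C |h|. Dividing by C + 1 rather than C covers the
       case C = 0. *)
    have : `|h| <= e / (C + 1).
      near: h.
      apply: (@dnbhs0_le R R^o).
      by rewrite divr_gt0// ltr_wpDl.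
    rewrite ler_pdivlMr ?ltr_wpDl// => /(le_trans _); apply.
    by rewrite mulrDr mulr1 mulrC lerDl.
  constructor; first by apply/cvg_ex; exists 0.
  exact/cvg_lim.
Unshelve. all: by end_near. Qed.

Lemma smooth_flat p : smooth (flat p).
Proof.
apply/smooth_derivablen => n; elim: n p => [p|n IH p].
  exact: derivablen0.
exact: derivablen_is_derive (is_derive_flat p) (IH _).
Qed.

(** Take s(x) = e(x) / (e(x) + e(1 - x)) with e(x) = exp(-1/x) for x > 0 and 0 otherwise. The
    denominator never vanishes, since x or 1 - x is positive. *)
Lemma smooth_step_exists : exists s : R -> R,
  [/\ smooth s, forall x, 0 <= s x <= 1, forall x, x <= 0 -> s x = 0
    & forall x, 1 <= x -> s x = 1].
Proof.
pose e := flat 1.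
have e_ge0 x : 0 <= e x.
  by rewrite /e /flat; case: ifP => // _; rewrite hornerC mul1r expR_ge0.
have e_gt0 x : 0 < x -> 0 < e x.
  by rewrite /e /flat => ->; rewrite hornerC mul1r expR_gt0.
have e_eq0 x : x <= 0 -> e x = 0 by rewrite /e /flat leNgt => /negbTE ->.
pose D x := e x + e (-1 * x + 1).
have D_gt0 x : 0 < D x.
  have [x0|x0] := ltP 0 x; first by rewrite ltr_pwDl// e_gt0.
  by rewrite ltr_wpDl// e_gt0//; lra.
exists (fun x => e x * (D x)^-1); split => [|x|x x0|x x1].
- apply: smoothM; first exact: smooth_flat.
  apply: smoothV => [x|]; first by rewrite gt_eqF.
  apply: smoothD; first exact: smooth_flat.
  by apply: smooth_comp; [exact: smooth_flat | exact: smooth_affine].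
- rewrite divr_ge0 ?(ltW (D_gt0 x))//= ler_pdivrMr// mul1r.
  by rewrite lerDl.
- by rewrite e_eq0// mul0r.
- rewrite /D (e_eq0 (-1 * x + 1)); last by lra.
  by rewrite addr0 divff// gt_eqF// e_gt0//; lra.
Qed.

End smooth_cutoffs.

(** * Test functions on the open unit interval *)

Section test_functions.
Context {R : realType}.
Implicit Types (u v g chi : R -> R).

Notation test g := (smooth_compact_support `]0, 1[ g).

Lemma test_itv (a b : R) g : 0 < a -> b < 1 -> smooth g ->
  (forall x, g x != 0 -> a <= x <= b) -> test g.
Proof.
move=> a0 b1 sg gab.
have sub : tsupport g `<=` `[a, b].
  have /closure_id cl : closed (`[a, b] : set R) by exact: interval_closed.
  rewrite [X in _ `<=` X]cl.
  by apply: closureS => x /= /gab; rewrite in_itv.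
split => //.
- apply: subclosed_compact sub; first exact: closed_closure.
  exact: segment_compact.
- move=> x /sub; rewrite /= !in_itv/= => /andP[ax xb].
  by rewrite (lt_le_trans a0 ax) (le_lt_trans xb b1).
Qed.

Lemma test_le g u : test g -> smooth u -> (forall x, g x = 0 -> u x = 0) ->
  test u.
Proof.
move=> [sg cg gU] su gu.
have sub : tsupport u `<=` tsupport g.
  apply: closureS => x /=; apply: contra_neq; exact: gu.
split => //; last exact: subset_trans gU.
by apply: subclosed_compact sub => //; exact: closed_closure.
Qed.

Lemma testM g u : test g -> smooth u -> test (fun x => g x * u x).
Proof.
move=> tg su; have [sg _ _] := tg.
by apply: (test_le tg (smoothM sg su)) => x ->; rewrite mul0r.
Qed.

Lemma test0 : test (fun=> 0 : R).
Proof.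
apply: (@test_itv 2^-1 2^-1); rewrite ?invr_gt0 ?invf_lt1 ?ltr1n//.
  exact: smooth_cst.
by move=> x; rewrite eqxx.
Qed.

Lemma testD u v : test u -> test v -> test (fun x => u x + v x).
Proof.
move=> [su cu uU] [sv cv vU].
have sub : tsupport (fun x => u x + v x) `<=` tsupport u `|` tsupport v.
  rewrite /tsupport -closureU; apply: closureS => x /=.
  have [->|] := eqVneq (u x) 0; last by left.
  by rewrite add0r; right.
split; first exact: smoothD.
  apply: subclosed_compact sub; first exact: closed_closure.
  exact: compactU.
by apply: subset_trans sub _ => x [/uU|/vU].
Qed.

Lemma test_sum (I : finType) (F : I -> R -> R) :
  (forall i, test (F i)) -> test (fun x => \sum_i F i x).
Proof.
move=> tF; rewrite (_ : (fun x => _) = \sum_i F i); last first.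
  by apply/funext => x; rewrite fct_sumE.
by elim/big_ind : _ => //; [exact: test0 | exact: testD].
Qed.

(** With N = n + 1, the product of a step rising on [1/N, 2/N] and a step falling on
    [1 - 2/N, 1 - 1/N]. For N < 4 the last condition is vacuous. *)
Lemma test_cutoff n : exists chi, [/\ test chi, forall x, 0 <= chi x <= 1 &
  forall x, 2 <= n.+1%:R * x -> 2 <= n.+1%:R * (1 - x) -> chi x = 1].
Proof.
have [s [ss s01 s0 s1]] := @smooth_step_exists R.
pose N : R := n.+1%:R; have N0 : 0 < N by rewrite ltr0n.
exists (fun x => s (N * x + -1) * s (- N * x + (N - 1))); split.
- apply: (@test_itv N^-1 (1 - N^-1)).
  + by rewrite invr_gt0.
  + by rewrite ltrBlDr ltrDl invr_gt0.
  + exact: (smoothM (smooth_comp ss (@smooth_affine _ _ _))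
      (smooth_comp ss (@smooth_affine _ _ _))).
  + move=> x; rewrite mulf_eq0 negb_or => /andP[h1 h2]; apply/andP; split.
      rewrite -[_^-1]mulr1 ler_pdivrMl//; rewrite leNgt.
      by apply: contra_neqN h1 => ?; apply: s0; lra.
    rewrite lerBrDr -lerBrDl -[_^-1]mulr1 ler_pdivrMl//; rewrite leNgt.
    apply: contra_neqN h2 => h; apply: s0.
    by rewrite mulrBr mulr1 in h; lra.
- move=> x; have /andP[a0 a1] := s01 (N * x + -1).
  have /andP[b0 b1] := s01 (- N * x + (N - 1)).
  by rewrite mulr_ge0//= mulr_ile1.
- move=> x h1 h2; rewrite !s1 ?mulr1//; last by lra.
  by rewrite mulrBr mulr1 in h2; rewrite /N; lra.
Qed.

Lemma continuous_bounded01 g : continuous g ->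
  exists2 M, 0 < M & forall x, `[0, 1]%classic x -> `|g x| <= M.
Proof.
move=> cg.
have cn : {within `[0, 1], continuous (fun x => `|g x|)}.
  apply: continuous_subspaceT => x.
  by apply: continuous_comp; [exact: cg | exact: norm_continuous].
have [c _ H] := EVT_max ler01 cn.
exists (`|g c| + 1); first by rewrite ltr_wpDl.
move=> x x01; apply: (@le_trans _ _ `|g c|); first exact: H.
by rewrite lerDl.
Qed.

End test_functions.

(** * Correcting a phase by contraction *)

Section integral_bounds.
Context d (T : measurableType d) (R : realType) (mu : {measure set T -> \bar R}).
Variables (D : set T) (mD : measurable D).
Implicit Types f g : T -> R.

Lemma integrable_mul_bounded f g (M : R) : mu.-integrable D (EFin \o f) ->
  measurable_fun D g -> (forall x, D x -> `|g x| <= M) ->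
  mu.-integrable D (EFin \o (fun x => f x * g x)).
Proof.
move=> fi mg gM.
have bg : [bounded g x | x in D].
  exists M; split; first exact: num_real.
  by move=> y My x Dx; exact: le_trans (gM x Dx) (ltW My).
have := integrableMl mD fi mg bg.
by apply: eq_integrable => // x _; rewrite /= EFinM.
Qed.

Lemma integrable_scale (r : R) f : mu.-integrable D (EFin \o f) ->
  mu.-integrable D (EFin \o (fun x => r * f x)).
Proof.
move=> fi; apply: (@eq_integrable _ _ _ mu D mD (fun x => r%:E * (EFin \o f) x)%E).
  by move=> x _; rewrite /= EFinM.
exact: integrableZl.
Qed.

Lemma integrable_add f g : mu.-integrable D (EFin \o f) ->
  mu.-integrable D (EFin \o g) ->
  mu.-integrable D (EFin \o (fun x => f x + g x)).
Proof.
by move=> fi gi; apply: eq_integrable (integrableD mD fi gi).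
Qed.

Lemma integrable_sub f g : mu.-integrable D (EFin \o f) ->
  mu.-integrable D (EFin \o g) ->
  mu.-integrable D (EFin \o (fun x => f x - g x)).
Proof.
by move=> fi gi; apply: eq_integrable (integrableB mD fi gi).
Qed.

Lemma integrable_fsum (I : Type) (s : seq I) (F : I -> T -> R) :
  (forall i, mu.-integrable D (EFin \o F i)) ->
  mu.-integrable D (EFin \o (fun x => \sum_(i <- s) F i x)).
Proof.
move=> Fi; apply: (@eq_integrable _ _ _ mu D mD
    (fun x => \sum_(i <- s) (EFin \o F i) x)%E).
  by move=> x _; rewrite /= sumEFin.
exact: integrable_sum.
Qed.

Lemma Rintegral_sum (I : Type) (s : seq I) (F : I -> T -> R) :
  (forall i, mu.-integrable D (EFin \o F i)) ->
  \int[mu]_(x in D) (\sum_(i <- s) F i x) =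
  \sum_(i <- s) \int[mu]_(x in D) F i x.
Proof.
move=> Fi; elim: s => [|i s IH].
  rewrite big_nil -[RHS](mul0r (fine (mu D))) -Rintegral_cst//.
  by apply: eq_Rintegral => x _; rewrite big_nil.
rewrite big_cons -IH -RintegralD//; last exact: integrable_fsum.
by apply: eq_Rintegral => x _; rewrite big_cons.
Qed.

Lemma norm_Rintegral_le f g : mu.-integrable D (EFin \o f) ->
  mu.-integrable D (EFin \o g) -> (forall x, D x -> `|f x| <= g x) ->
  `|\int[mu]_(x in D) f x| <= \int[mu]_(x in D) g x.
Proof.
move=> fi gi fg; apply: le_trans (le_normr_Rintegral mD fi) _.
by apply: le_Rintegral => //; exact: integrable_norm.
Qed.

Lemma norm_Rintegral_mul_le f g (M : R) : mu.-integrable D (EFin \o f) ->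
  measurable_fun D g -> (forall x, D x -> `|g x| <= M) ->
  `|\int[mu]_(x in D) (f x * g x)| <= M * \int[mu]_(x in D) `|f x|.
Proof.
move=> fi mg gM; rewrite -RintegralZl//; last exact: integrable_norm.
apply: norm_Rintegral_le.
- exact: integrable_mul_bounded gM.
- by apply: integrable_scale; exact: integrable_norm.
- by move=> x Dx; rewrite normrM mulrC ler_wpM2r// gM.
Qed.

End integral_bounds.

Section taylor.
Context {R : realType}.
Implicit Types (w e : R -> R).

Lemma mean_value w e x y : (forall z : R, is_derive z 1 w (e z)) ->
  exists2 c, Num.min x y <= c <= Num.max x y & w x - w y = e c * (x - y).
Proof.
move=> dw; have cw : continuous w.
  move=> z; apply: differentiable_continuous; apply/derivable1_diffP.
  exact: (@ex_derive _ _ _ _ _ _ _ (dw z)).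
have MV (a b : R) : a <= b -> exists2 c, a <= c <= b & w b - w a = e c * (b - a).
  move=> ab; have [c] := MVT_segment ab (fun z _ => dw z) (continuous_subspaceT cw).
  by rewrite in_itv/= => ? ?; exists c.
have [xy|yx] := leP x y.
  have [c cxy E] := MV x y xy; exists c => //.
  by rewrite -(opprB (w y)) E -mulrN opprB.
by have [c cxy E] := MV y x (ltW yx); exists c.
Qed.

Lemma lipschitz1 w e x y : (forall z : R, is_derive z 1 w (e z)) ->
  (forall z, `|e z| <= 1) -> `|w x - w y| <= `|x - y|.
Proof.
move=> dw e1; have [c _ ->] := mean_value x y dw.
by rewrite normrM -[leRHS]mul1r ler_wpM2r.
Qed.

(** The mean value theorem gives a point c between s + u and s + v. It is within |u| + |v| of s, so
    the Lipschitz bound controls e(c) - e(s). *)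
Lemma taylor_le w e s u v : (forall z : R, is_derive z 1 w (e z)) ->
  (forall x y, `|e x - e y| <= `|x - y|) ->
  `|w (s + u) - w (s + v) - e s * (u - v)| <= (`|u| + `|v|) * `|u - v|.
Proof.
move=> dw eL; have [c cuv ->] := mean_value (s + u) (s + v) dw.
rewrite (_ : s + u - (s + v) = u - v); last by ring.
rewrite -mulrBl normrM ler_wpM2r//.
apply: le_trans (eL _ _) _; move: cuv => /andP[].
have := ler_norm u; have := ler_norm v.
have := lerNnormlW (lexx `|u|); have := lerNnormlW (lexx `|v|).
have := normr_ge0 u; have := normr_ge0 v.
rewrite ge_min le_max ler_norml => h1 h2 h3 h4 h5 h6 /orP[] h7 /orP[] h8; lra.
Qed.

End taylor.

(** Joins completeness with the norm of matrices, so that the Banach fixed point theorem applies to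
    them. *)
HB.instance Definition _ (R : realType) (p q : nat) :=
  Complete.on 'M[R]_(p, q).

Section near_identity.
Context {R : realType} (p q : nat).
Implicit Types c : 'M[R]_(p, q).

Lemma mx_norm_le c (r : R) : 0 <= r -> (forall i j, `|c i j| <= r) -> `|c| <= r.
Proof.
move=> r0 cr; rewrite -[leLHS]/(mx_norm c) mx_normrE.
by apply: bigmax_le => // -[i j] _; exact: cr.
Qed.

Lemma mx_entry_le_norm c i j : `|c i j| <= `|c|.
Proof.
rewrite -[leRHS]/(mx_norm c) mx_normrE.
exact: (le_bigmax 0 (fun ij => `|c ij.1 ij.2|) (i, j)).
Qed.

(** Zeros of F are fixed points of c - F c, which contracts by 1/2. The bound on F 0 keeps the ball
    of radius r invariant: r/2 comes from the contraction and r/2 from F 0. *)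
Lemma near_identity_zero (F : 'M[R]_(p, q) -> 'M[R]_(p, q)) (r : R) : 0 <= r ->
  (forall c c', `|c| <= r -> `|c'| <= r ->
    `|(c - c') - (F c - F c')| <= 2^-1 * `|c - c'|) ->
  `|F 0| <= 2^-1 * r ->
  exists c, `|c| <= r /\ F c = 0.
Proof.
move=> r0 FL F0.
pose U := [set c : 'M[R]_(p, q) | `|c| <= r].
pose G c := c - F c.
have GU : {homo G : c / U c >-> U c}.
  move=> c Uc; rewrite /U/= /G.
  have -> : c - F c = (c - 0 - (F c - F 0)) - F 0.
    by rewrite subr0 opprB addrA addrAC addrK.
  apply: le_trans (ler_normB _ _) _.
  have := FL c 0 Uc; rewrite normr0 subr0 => /(_ r0).
  move: (Uc); rewrite /U/= => h1 h2; lra.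
have ctr : is_contraction (mkfun_fun GU).
  exists (2^-1)%:nng; split; first by rewrite /= invf_lt1// ltr1n.
  move=> [c c'] [/= Uc Uc'].
  have -> : mkfun GU c - mkfun GU c' = (c - c') - (F c - F c').
    by rewrite /mkfun /G !opprB addrACA [RHS]addrACA; congr (_ + _); rewrite addrC.
  exact: FL.
have [||c Uc E] := banach_fixed_point ctr.
- apply: (@closed_comp _ _ (fun c : 'M[R]_(p, q) => `|c|) [set x | x <= r]);
    last exact: closed_le.
  by move=> c _; exact: norm_continuous.
- by exists 0; rewrite /U/= normr0.
exists c; split => //.
have -> : F c = c - (c - F c) by rewrite opprB addrC subrK.
by move: E; rewrite /= /mkfun /G => <-; rewrite subrr.
Qed.

End near_identity.

Section nonlinear_correction.
Context d (T : measurableType d) (R : realType) (mu : {measure set T -> \bar R}).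
Variables (D : set T) (mD : measurable D).

Lemma is_derive_continuous (w e : R -> R) :
  (forall z : R, is_derive z 1 w (e z)) -> continuous w.
Proof.
move=> dw z; apply: differentiable_continuous; apply/derivable1_diffP.
exact: (@ex_derive _ _ _ _ _ _ _ (dw z)).
Qed.

Lemma lipschitz1_continuous (e : R -> R) :
  (forall x y, `|e x - e y| <= `|x - y|) -> continuous e.
Proof.
move=> eL x; apply/cvgrPdist_lt => eps eps0; near=> y.
apply: le_lt_trans (eL _ _) _; near: y; exact: cvgr_dist_lt.
Unshelve. all: by end_near. Qed.

Lemma measurable_fsum (I : finType) (c : I -> R) (psi : I -> T -> R) :
  (forall i, measurable_fun D (psi i)) ->
  measurable_fun D (fun x => \sum_i c i * psi i x).
Proof.
by move=> mpsi; apply: measurable_sum => i; apply: measurable_funM.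
Qed.

Lemma norm_sum_le_card (I : finType) (F : I -> R) (M : R) :
  (forall i, `|F i| <= M) -> `|\sum_i F i| <= #|I|%:R * M.
Proof.
move=> FM; apply: le_trans (ler_norm_sum _ _ _) _.
apply: le_trans (ler_sum _ (fun i _ => FM i)) _.
by rewrite sumr_const mulr_natl.
Qed.

(* [theta + \sum_j c j * psi j] perturbs the phase [theta]; to first order in
   [c] the [i]-th integral changes by [c i], so that a contraction argument in
   [c] annihilates all the integrals. *)
Lemma phase_correction (I : finType) (q : I -> T -> R) (w e : I -> R -> R)
    (K : R) :
  (forall i, mu.-integrable D (EFin \o q i)) ->
  (forall i z, is_derive (z : R) 1 (w i) (e i z)) ->
  (forall i x y, `|e i x - e i y| <= `|x - y|) ->
  (forall i z, `|w i z| <= 1) -> (forall i z, `|e i z| <= 1) -> 0 <= K ->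
  exists2 eps : R, 0 < eps & forall (psi : I -> T -> R) (theta : T -> R),
    (forall i, measurable_fun D (psi i)) -> measurable_fun D theta ->
    (forall i x, D x -> `|psi i x| <= K) ->
    (forall i, `|\int[mu]_(x in D) (q i x * w i (theta x))| <= eps) ->
    (forall i j, `|\int[mu]_(x in D) (q i x * (e i (theta x) * psi j x))
                   - (i == j)%:R| <= eps) ->
    exists c : I -> R, forall i,
      \int[mu]_(x in D) (q i x * w i (theta x + \sum_j c j * psi j x)) = 0.
Proof.
move=> qi dw eL w1 e1 K0.
have cw i : continuous (w i) by exact: is_derive_continuous (dw i).
have ce i : continuous (e i) by exact: lipschitz1_continuous (eL i).
pose n : R := #|I|%:R; have n0 : 0 <= n by rewrite ler0n.
pose B := n * K; have B0 : 0 <= B by rewrite mulr_ge0.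
pose A := \sum_i \int[mu]_(x in D) `|q i x|.
have Ai i : \int[mu]_(x in D) `|q i x| <= A.
  rewrite /A (bigD1 i)//= lerDl; apply: sumr_ge0 => j _.
  exact: Rintegral_ge0.
have A0 : 0 <= A by apply: sumr_ge0 => i _; exact: Rintegral_ge0.
(* [A] bounds the L1 norms of the [q i], and [B] times |c| bounds the perturbation of the phase. On
   the ball of radius [r] the Taylor remainder contributes at most 2 A B^2 r |c - c'|, which this
   choice makes at most |c - c'| / 4. *)
pose r := (8 * (A + 1) * (B + 1) ^+ 2)^-1.
have r0 : 0 < r by rewrite invr_gt0 !mulr_gt0// ?exprn_gt0// ltr_wpDl.
have ABr : A * (B + B) * B * r <= 4^-1.
  rewrite /r ler_pdivrMr; last by rewrite !mulr_gt0// ?exprn_gt0// ltr_wpDl.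
  have := mulr_ge0 A0 B0; have := mulr_ge0 (mulr_ge0 A0 B0) B0.
  by have := sqr_ge0 B; rewrite expr2 => ? ? ?; nra.
(* The first bound keeps F 0 below r/2. The second makes the [n] errors of the linear part add up to
   at most 1/4, so that with the remainder the Lipschitz constant is 1/2. *)
pose eps := Num.min (2^-1 * r) (4 * (n + 1))^-1.
have eps0 : 0 < eps.
  by rewrite lt_min mulr_gt0// ?invr_gt0//= mulr_gt0// ltr_wpDl.
have epsr : eps <= 2^-1 * r by rewrite ge_min lexx.
have epsn : n * eps <= 4^-1.
  have : eps <= (4 * (n + 1))^-1 by rewrite ge_min lexx orbT.
  rewrite -[_^-1]mul1r ler_pdivlMr; last by rewrite mulr_gt0// ltr_wpDl.
  by move=> h; move: (ltW eps0) => ?; nra.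
exists eps => // psi theta mpsi mtheta psiK w0 ee.
(* The coefficients become a row vector, enumerated along [I], because the fixed point argument runs
   in a matrix space with the sup norm. *)
pose C (c : 'rV[R]_#|I|) i := c ord0 (enum_rank i).
pose h c x := \sum_j C c j * psi j x.
have mh c : measurable_fun D (h c) by exact: measurable_fsum.
have mwh i c : measurable_fun D (fun x => w i (theta x + h c x)).
  apply: (measurableT_comp (continuous_measurable_fun (cw i))).
  exact: measurable_funD.
have mepsi i j : measurable_fun D (fun x => e i (theta x) * psi j x).
  apply: measurable_funM => //.
  exact: (measurableT_comp (continuous_measurable_fun (ce i))).
have hle c x : D x -> `|h c x| <= B * `|c|.
  move=> Dx; rewrite /B -mulrA; apply: norm_sum_le_card => j.
  by rewrite normrM mulrC ler_pM// ?psiK// mx_entry_le_norm.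
have hB c c' x : h c x - h c' x = h (c - c') x.
  rewrite /h -sumrB; apply: eq_bigr => j _.
  by rewrite /C !mxE mulrBl.
pose P i c := \int[mu]_(x in D) (q i x * w i (theta x + h c x)).
have iP i c : mu.-integrable D (EFin \o (fun x => q i x * w i (theta x + h c x))).
  exact: (integrable_mul_bounded mD (M := 1)).
have ie i j : mu.-integrable D
    (EFin \o (fun x => q i x * (e i (theta x) * psi j x))).
  apply: (integrable_mul_bounded mD (M := K)) => // x Dx.
  by rewrite normrM -[K]mul1r ler_pM// psiK.
pose F c : 'rV[R]_#|I| := \row_j P (enum_val j) c.
have [||c [_ Fc]] := @near_identity_zero R 1 #|I| F r (ltW r0).
- move=> c c' cr c'r; apply: mx_norm_le => [|i0 j]; first by rewrite mulr_ge0.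
  rewrite (ord1 i0) => {i0}; set i := enum_val j.
  pose D' := c - c'.
  pose rho x := w i (theta x + h c x) - w i (theta x + h c' x)
                - e i (theta x) * (h c x - h c' x).
  pose E k := \int[mu]_(x in D) (q i x * (e i (theta x) * psi k x)) - (i == k)%:R.
  have mrho : measurable_fun D rho.
    apply: measurable_funB; first exact: measurable_funB.
    apply: measurable_funM; last exact: measurable_funB.
    exact: (measurableT_comp (continuous_measurable_fun (ce i))).
  have rho_le x : D x -> `|rho x| <= (B + B) * r * (B * `|D'|).
    move=> Dx; apply: le_trans (taylor_le _ _ _ (dw i) (eL i)) _.
    rewrite hB; apply: ler_pM; [exact: addr_ge0|exact: normr_ge0| |exact: hle].
    rewrite mulrDl; apply: lerD; apply: le_trans (hle _ _ Dx) _;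
      exact: ler_wpM2l.
  have irho : mu.-integrable D (EFin \o (fun x => q i x * rho x)).
    exact: integrable_mul_bounded rho_le.
  (* The increment is the Taylor remainder, plus the identity, plus the error [E] of the linear
     part. *)
  have key : P i c - P i c' = \int[mu]_(x in D) (q i x * rho x)
      + (C D' i + \sum_k C D' k * E k).
    have -> : C D' i + \sum_k C D' k * E k = \int[mu]_(x in D)
        (\sum_k C D' k * (q i x * (e i (theta x) * psi k x))).
      rewrite Rintegral_sum//; last first.
        by move=> k; apply: integrable_scale => //; exact: ie.
      under [RHS]eq_bigr => k _ do rewrite RintegralZl//.
      have S : \sum_k C D' k * (i == k)%:R = C D' i.
        rewrite (bigD1 i)//= eqxx mulr1 big1 ?addr0// => k ki.
        by rewrite eq_sym (negbTE ki) mulr0.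
      under [in LHS]eq_bigr => k _ do rewrite /E mulrBr.
      by rewrite sumrB S addrC subrK.
    rewrite -RintegralB// -RintegralD//; last first.
      by apply: integrable_fsum => // k; apply: integrable_scale => //; exact: ie.
    apply: eq_Rintegral => x _; rewrite /rho hB.
    have -> : \sum_k C D' k * (q i x * (e i (theta x) * psi k x))
        = q i x * (e i (theta x) * h D' x).
      rewrite /h !mulr_sumr; apply: eq_bigr => k _; ring.
    rewrite -/D'; ring.
  have -> : ((c - c') - (F c - F c')) ord0 j
      = - (\int[mu]_(x in D) (q i x * rho x)) - \sum_k C D' k * E k.
    have CD : C D' i = c ord0 j - c' ord0 j.
      by rewrite /C /i enum_valK /D' !mxE.
    rewrite !mxE -/i key CD; ring.
  apply: le_trans (ler_normB _ _) _; rewrite normrN.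
  have H1 : `|\int[mu]_(x in D) (q i x * rho x)| <= 4^-1 * `|D'|.
    apply: le_trans (norm_Rintegral_mul_le _ _ _ rho_le) _ => //.
    apply: (@le_trans _ _ ((B + B) * r * (B * `|D'|) * A)).
      by apply: ler_wpM2l => //; rewrite !mulr_ge0// ?addr_ge0// ltW.
    rewrite (_ : _ * A = (A * (B + B) * B * r) * `|D'|); last by ring.
    by rewrite ler_wpM2r.
  have H2 : `|\sum_k C D' k * E k| <= 4^-1 * `|D'|.
    apply: (@le_trans _ _ (n * eps * `|D'|)); last by rewrite ler_wpM2r.
    rewrite -mulrA; apply: norm_sum_le_card => k.
    by rewrite normrM mulrC ler_pM// ?ee// mx_entry_le_norm.
  by rewrite -/D'; lra.
- apply: mx_norm_le => [|i0 j]; first by rewrite mulr_ge0// ltW.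
  apply: le_trans epsr; rewrite mxE /P.
  rewrite (_ : \int[mu]_(x in D) _ =
    \int[mu]_(x in D) (q (enum_val j) x * w (enum_val j) (theta x))).
    exact: w0.
  apply: eq_Rintegral => x _; rewrite /h big1 ?addr0// => k _.
  by rewrite /C mxE mul0r.
exists (C c) => i.
have := congr1 (fun M : 'rV[R]_#|I| => M ord0 (enum_rank i)) Fc.
by rewrite !mxE enum_rankK.
Qed.

End nonlinear_correction.

(** * The Riemann-Lebesgue lemma *)

Section bessel.
Import HBSimple.
Context d (T : measurableType d) (R : realType) (mu : {measure set T -> \bar R}).
Variables (D : set T) (mD : measurable D) (Doo : (mu D < +oo)%E).

(** On a set of finite measure such functions are integrable and, unlike integrable functions in
    general, they are stable under products. All integrals in the Bessel argument therefore
    exist. *)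
Definition bounded_measurable (g : T -> R) :=
  measurable_fun D g /\ exists M, forall x, D x -> `|g x| <= M.

Lemma bounded_measurableM f g : bounded_measurable f -> bounded_measurable g ->
  bounded_measurable (fun x => f x * g x).
Proof.
move=> [mf [M fM]] [mg [N gN]]; split; first exact: measurable_funM.
by exists (M * N) => x Dx; rewrite normrM ler_pM// ?fM// gN.
Qed.

Lemma bounded_measurable_cst r : bounded_measurable (fun=> r).
Proof. by split => //; exists `|r|. Qed.

Lemma bounded_measurable_sum (I : Type) (s : seq I) (F : I -> T -> R) :
  (forall i, bounded_measurable (F i)) ->
  bounded_measurable (fun x => \sum_(i <- s) F i x).
Proof.
move=> bF; split; first by apply: measurable_sum => i; case: (bF i).
elim: s => [|i s [M HM]].
  by exists 0 => x _; rewrite big_nil normr0.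
have [_ [N HN]] := bF i; exists (N + M) => x Dx; rewrite big_cons.
by apply: le_trans (ler_normD _ _) _; rewrite lerD ?HN ?HM.
Qed.

Lemma bounded_measurable_integrable g : bounded_measurable g ->
  mu.-integrable D (EFin \o g).
Proof.
move=> [mg [M gM]]; apply: measurable_bounded_integrable => //.
exists M; split; first exact: num_real.
by move=> y My x Dx; exact: le_trans (gM x Dx) (ltW My).
Qed.

Variable e : nat -> T -> R.
Hypothesis be : forall k, bounded_measurable (e k).
Hypothesis orth_e : forall k l,
  \int[mu]_(x in D) (e k x * e l x) = (k == l)%:R / 2.

Lemma bessel f : bounded_measurable f -> forall n,
  \sum_(k < n) (\int[mu]_(x in D) (f x * e k x)) ^+ 2
  <= 2^-1 * \int[mu]_(x in D) (f x * f x).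
Proof.
move=> bf n; pose c k := \int[mu]_(x in D) (f x * e k x).
pose S x := \sum_(k < n) (2 * c k) * e k x.
have bce k : bounded_measurable (fun x => (2 * c k) * e k x).
  by apply: bounded_measurableM; [exact: bounded_measurable_cst|].
have bS : bounded_measurable S by exact: bounded_measurable_sum.
have bi := bounded_measurable_integrable.
have bM := bounded_measurableM.
have IfS : \int[mu]_(x in D) (f x * S x) = 2 * \sum_(k < n) c k ^+ 2.
  rewrite (_ : \int[mu]_(x in D) _ = \int[mu]_(x in D)
      \sum_(k < n) (2 * c k) * (f x * e k x)); last first.
    apply: eq_Rintegral => x _; rewrite mulr_sumr; apply: eq_bigr => k _; ring.
  rewrite Rintegral_sum//; last first.
    by move=> k; apply: integrable_scale => //; apply: bi; exact: bM.
  rewrite mulr_sumr; apply: eq_bigr => k _.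
  rewrite RintegralZl//; last by apply: bi; exact: bM.
  by rewrite -/(c k) expr2 mulrA.
have IeS (k : 'I_n) : \int[mu]_(x in D) (e k x * S x) = c k.
  rewrite (_ : \int[mu]_(x in D) _ = \int[mu]_(x in D)
      \sum_(l < n) (2 * c l) * (e k x * e l x)); last first.
    apply: eq_Rintegral => x _; rewrite mulr_sumr; apply: eq_bigr => l _; ring.
  rewrite Rintegral_sum//; last first.
    by move=> l; apply: integrable_scale => //; apply: bi; exact: bM.
  rewrite (bigD1 k)//= big1 ?addr0 => [|l lk]; rewrite RintegralZl//;
    try by apply: bi; exact: bM.
    by rewrite orth_e eqxx (_ : true%:R = 1 :> R)//; field.
  by rewrite orth_e eq_sym (_ : (_ == _) = false) ?mul0r ?mulr0//; exact/negbTE.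
have ISS : \int[mu]_(x in D) (S x * S x) = 2 * \sum_(k < n) c k ^+ 2.
  rewrite (_ : \int[mu]_(x in D) _ = \int[mu]_(x in D)
      \sum_(k < n) (2 * c k) * (e k x * S x)); last first.
    apply: eq_Rintegral => x _; rewrite {1}/S mulr_suml.
    by apply: eq_bigr => k _; ring.
  rewrite Rintegral_sum//; last first.
    by move=> k; apply: integrable_scale => //; apply: bi; exact: bM.
  rewrite mulr_sumr; apply: eq_bigr => k _.
  rewrite RintegralZl//; last by apply: bi; exact: bM.
  by rewrite IeS expr2 mulrA.
have : 0 <= \int[mu]_(x in D) ((f x * f x - 2 * (f x * S x)) + S x * S x).
  apply: Rintegral_ge0 => x _.
  rewrite (_ : _ + _ = (f x - S x) ^+ 2); last by ring.
  exact: sqr_ge0.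
have iff := bi _ (bM _ _ bf bf); have ifS := bi _ (bM _ _ bf bS).
have iSS := bi _ (bM _ _ bS bS).
rewrite RintegralD//; last by apply: integrable_sub => //; exact: integrable_scale.
rewrite RintegralB//; last exact: integrable_scale.
rewrite RintegralZl// IfS ISS; rewrite -/c => h.
have -> : \sum_(k < n) (\int[mu]_(x in D) (f x * e k x)) ^+ 2
  = \sum_(k < n) c k ^+ 2 by [].
lra.
Qed.

Hypothesis e1 : forall k x, D x -> `|e k x| <= 1.

(** For bounded f the squared coefficients are summable by Bessel, hence tend to 0. An integrable f
    is approximated in L1 by a simple function; as |e_k| <= 1, the error is uniform in k. *)
Lemma bessel_cvg0 f : mu.-integrable D (EFin \o f) ->
  \int[mu]_(x in D) (f x * e k x) @[k --> \oo] --> (0 : R).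
Proof.
move=> fi.
have bounded_case g : bounded_measurable g ->
    \int[mu]_(x in D) (g x * e k x) @[k --> \oo] --> (0 : R).
  move=> bg; pose c k := \int[mu]_(x in D) (g x * e k x).
  have c2 : (fun k => c k ^+ 2) @ \oo --> (0 : R).
    apply: cvg_series_cvg_0; apply: nondecreasing_is_cvgn.
      apply/nondecreasing_seqP => n.
      by rewrite /series/= big_nat_recr//= lerDl sqr_ge0.
    exists (2^-1 * \int[mu]_(x in D) (g x * g x)) => _ [n _ <-].
    by rewrite /series/= big_mkord; exact: bessel.
  apply/cvgr0Pnorm_lt => eps eps0.
  have /cvgr0Pnorm_lt/(_ _ (exprn_gt0 2 eps0)) := c2; apply: filterS => k.
  by rewrite normrX ltr_pXn2r// nnegrE// ltW.
have [g_ [gi _ gf]] := approximation_sfun_integrable mD fi.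
apply/cvgr0Pnorm_lt => eps eps0.
have eps2 : 0 < eps / 2 by rewrite divr_gt0.
have [g [bg fg]] : exists g, bounded_measurable g /\
    \int[mu]_(x in D) `|f x - g x| < eps / 2.
  move/fine_cvgP : gf => [fin lim0].
  near \oo => n; exists (g_ n); split.
    split; first by apply: measurable_funTS; exact: measurable_funP.
    have [M [_ bM]] := simple_bounded (g_ n).
    by exists (M + 1) => x _; apply: bM => //; rewrite ltrDl.
  near: n; have /cvgr0Pnorm_lt/(_ _ eps2) := lim0.
  apply: filterS => n /=; apply: le_lt_trans.
  exact: ler_norm.
have gI := bounded_measurable_integrable bg.
have fgI := integrable_sub mD fi gI.
have eI u k : mu.-integrable D (EFin \o u) ->
    mu.-integrable D (EFin \o (fun x => u x * e k x)).
  move=> ui; apply: (integrable_mul_bounded mD ui) (e1 k); exact: (be k).1.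
have /cvgr0Pnorm_lt/(_ _ eps2) := bounded_case g bg.
apply: filterS => k /= gk.
have -> : \int[mu]_(x in D) (f x * e k x) =
    \int[mu]_(x in D) ((f x - g x) * e k x) + \int[mu]_(x in D) (g x * e k x).
  rewrite -RintegralD//; [|exact: eI|exact: eI].
  by apply: eq_Rintegral => x _; rewrite mulrBl subrK.
apply: le_lt_trans (ler_normD _ _) _.
rewrite [ltRHS](splitr eps); apply: ltrD => //.
apply: le_lt_trans fg; rewrite -[leRHS]mul1r.
exact: (norm_Rintegral_mul_le mD fgI (be k).1 (e1 k)).
Unshelve. all: by end_near. Qed.

End bessel.

(** * Completed Lebesgue measure on the unit interval *)

Section completed_lebesgue.
Context {R : realType}.
Notation mu := (@completed_lebesgue_measure R).
Notation cR := (caratheodory_type ((wlength (@idfun R))^*)%mu).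
Notation I01 := (`[(0 : R), 1]%classic).
Notation test g := (smooth_compact_support `]0, 1[ g).

(** The identity from the completed sigma-algebra to the Borel one is measurable; composing with it
    transfers the measurability of continuous functions. *)
Lemma measurable_id_completed D :
  measurable_fun D (fun x : cR => (x : measurableTypeR R)).
Proof.
by move=> mD Y mY; apply: measurableI => //; exact: sub_caratheodory.
Qed.

Lemma measurable_itv_completed (i : interval R) :
  measurable ([set` i] : set cR).
Proof. by apply: sub_caratheodory; exact: measurable_itv. Qed.

Let mI01 : measurable (I01 : set cR) := measurable_itv_completed _.

Lemma completed_lebesgue_itv01 : mu I01 = 1%E.
Proof.
transitivity (@lebesgue_measure R I01) => //.
by rewrite lebesgue_measure_itv/= lte_fin ltr01 oppr0 adde0.
Qed.

Let I01oo : (mu I01 < +oo)%E.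
Proof. by rewrite completed_lebesgue_itv01 ltry. Qed.

Lemma continuous_measurable_completed D (g : R -> R) : continuous g ->
  measurable_fun (D : set cR) (g : cR -> R).
Proof.
move=> cg.
exact: (measurableT_comp (continuous_measurable_fun cg)
  (measurable_id_completed (D := D))).
Qed.

Lemma smooth_measurable_completed D (g : R -> R) : smooth g ->
  measurable_fun (D : set cR) (g : cR -> R).
Proof. by move=> sg; exact/continuous_measurable_completed/smooth_continuous. Qed.

Lemma continuous_bounded_measurable (g : R -> R) : continuous g ->
  bounded_measurable (I01 : set cR) (g : cR -> R).
Proof.
move=> cg; split; first exact: continuous_measurable_completed.
by have [M _ gM] := continuous_bounded01 cg; exists M.
Qed.

(** Change of variables along the identity, which pushes the completed measure forward to Lebesgue
    measure on Borel sets. It gives access to the fundamental theorem of calculus. *)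
Lemma Rintegral_completed (g : R -> R) : continuous g ->
  \int[mu]_(x in I01) g x = \int[lebesgue_measure]_(x in I01) g x.
Proof.
move=> cg; congr fine; apply/esym.
have mg : measurable_fun [set: measurableTypeR R] (EFin \o g).
  by apply/measurable_EFinP; exact: continuous_measurable_fun.
have ig : mu.-integrable I01 (EFin \o g).
  by apply: bounded_measurable_integrable => //; exact: continuous_bounded_measurable.
by rewrite -[RHS](@integral_pushforward _ _ _ _ _ _
    (measurable_id_completed (D := setT)) mu I01 _ mg ig).
Qed.

Lemma Rintegral01_FTC2 (F f : R -> R) : (forall x : R, is_derive x 1 F (f x)) ->
  continuous f -> \int[mu]_(x in I01) f x = F 1 - F 0.
Proof.
move=> dF cf; rewrite Rintegral_completed// /Rintegral.
have cF := is_derive_continuous dF.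
rewrite (continuous_FTC2 (F := F) ltr01)//.
- exact: continuous_subspaceT.
- split=> [x _||].
  + exact: (@ex_derive _ _ _ _ _ _ _ (dF x)).
  + by apply: cvg_at_right_filter; exact: cF.
  + by apply: cvg_at_left_filter; exact: cF.
- by move=> x _; rewrite derive1E; have := dF x => ?; rewrite derive_val.
Qed.

(** * Orthogonality of cosines and sines of integer frequency *)

Lemma Rintegral01_cos (a : R) : a != 0 -> sin a = 0 ->
  \int[mu]_(x in I01) cos (a * x) = 0.
Proof.
move=> a0 sa.
have dF (x : R) : is_derive x 1 (fun y => a^-1 * sin (a * y)) (cos (a * x)).
  have dl : is_derive x 1 (fun y : R => a * y) a.
    have := is_deriveZ a (is_derive_id x (1 : R)).
    by rewrite /GRing.scale/= mulr1.
  have ds := @is_derive1_comp R sin (fun y : R => a * y) x _ _ (is_derive_sin _) dl.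
  have := is_deriveZ a^-1 ds.
  by rewrite /GRing.scale/= mulrCA mulVf// mulr1.
rewrite (Rintegral01_FTC2 dF).
  by rewrite mulr1 mulr0 sin0 sa subrr.
apply: smooth_continuous; apply: smooth_comp; first exact: smooth_cos.
by apply: smoothM; [exact: smooth_cst|exact: smooth_id].
Qed.

(** The shift to k + 1 excludes frequency 0, so that sums of two frequencies never vanish and all
    squared norms are 1/2. *)
Definition freq (k : nat) : R := (pi *+ 2) *+ k.+1.

Lemma freq_gt0 k : 0 < freq k.
Proof. by rewrite /freq -mulrnA -mulr_natl mulr_gt0 ?ltr0n ?muln_gt0 ?pi_gt0. Qed.

Lemma sin_freq k : sin (freq k) = 0.
Proof. by rewrite -[freq k]add0r (periodicn (@sinD2pi R)) sin0. Qed.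

Lemma freq_inj : injective freq.
Proof.
have pi2 : 0 < pi *+ 2 :> R by rewrite -mulr_natl mulr_gt0 ?pi_gt0.
move=> k l; rewrite /freq -(mulr_natl _ k.+1) -(mulr_natl _ l.+1).
by move=> /(mulIf (lt0r_neq0 pi2))/eqP; rewrite eqr_nat => /eqP[].
Qed.

(** Doubled frequencies stay in the family, so the Riemann-Lebesgue lemma also handles the double
    angle. *)
Lemma double_freq k : 2 * freq k = freq k.*2.+1.
Proof. by rewrite /freq mulr_natl -mulrnA muln2 doubleS. Qed.

Lemma smooth_cosl (a : R) : smooth (fun x => cos (a * x)).
Proof.
apply: smooth_comp; first exact: smooth_cos.
by apply: smoothM; [exact: smooth_cst|exact: smooth_id].
Qed.

Lemma smooth_sinl (a : R) : smooth (fun x => sin (a * x)).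
Proof.
apply: smooth_comp; first exact: smooth_sin.
by apply: smoothM; [exact: smooth_cst|exact: smooth_id].
Qed.

Lemma Rintegral_cos_freqB k l :
  \int[mu]_(x in I01) cos ((freq k - freq l) * x) = (k == l)%:R.
Proof.
have [->|kl] := eqVneq k l.
  transitivity (\int[mu]_(x in I01) (cos 0 : R)).
    by apply: eq_Rintegral => x _; rewrite subrr mul0r.
  rewrite cos0 Rintegral_cst// mul1r.
  exact: (congr1 fine completed_lebesgue_itv01).
apply: Rintegral01_cos.
  by rewrite subr_eq0; apply: contra_neq kl; exact: freq_inj.
by rewrite sinB !sin_freq mul0r mulr0 subrr.
Qed.

Lemma Rintegral_cos_freqD k l :
  \int[mu]_(x in I01) cos ((freq k + freq l) * x) = 0.
Proof.
apply: Rintegral01_cos; first by rewrite gt_eqF// addr_gt0// freq_gt0.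
by rewrite sinD !sin_freq mul0r mulr0 addr0.
Qed.

Let smooth_int (g : R -> R) : smooth g -> mu.-integrable I01 (EFin \o g).
Proof.
move=> sg; apply: bounded_measurable_integrable => //.
exact/continuous_bounded_measurable/smooth_continuous.
Qed.

Lemma orth_cos k l :
  \int[mu]_(x in I01) (cos (freq k * x) * cos (freq l * x)) = (k == l)%:R / 2.
Proof.
transitivity (\int[mu]_(x in I01)
    (2^-1 * (cos ((freq k - freq l) * x) + cos ((freq k + freq l) * x)))).
  by apply: eq_Rintegral => x _; rewrite mulrBl mulrDl cosB cosD; field.
have i1 := smooth_int (@smooth_cosl (freq k - freq l)).
have i2 := smooth_int (@smooth_cosl (freq k + freq l)).
rewrite RintegralZl//; last exact: integrable_add.
rewrite RintegralD// Rintegral_cos_freqB Rintegral_cos_freqD addr0.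
by rewrite mulrC.
Qed.

Lemma orth_sin k l :
  \int[mu]_(x in I01) (sin (freq k * x) * sin (freq l * x)) = (k == l)%:R / 2.
Proof.
transitivity (\int[mu]_(x in I01)
    (2^-1 * (cos ((freq k - freq l) * x) - cos ((freq k + freq l) * x)))).
  by apply: eq_Rintegral => x _; rewrite mulrBl mulrDl cosB cosD; field.
have i1 := smooth_int (@smooth_cosl (freq k - freq l)).
have i2 := smooth_int (@smooth_cosl (freq k + freq l)).
rewrite RintegralZl//; last exact: integrable_sub.
rewrite RintegralB// Rintegral_cos_freqB Rintegral_cos_freqD subr0.
by rewrite mulrC.
Qed.

Lemma riemann_lebesgue_cos (u : cR -> R) : mu.-integrable I01 (EFin \o u) ->
  \int[mu]_(x in I01) (u x * cos (freq k * x)) @[k --> \oo] --> (0 : R).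
Proof.
move=> ui.
have be k : bounded_measurable (I01 : set cR) (fun x => cos (freq k * x)).
  by apply/continuous_bounded_measurable/smooth_continuous/smooth_cosl.
have e1 k (x : R) : I01 x -> `|cos (freq k * x)| <= 1 by move=> _; exact: cos_max.
exact: (bessel_cvg0 mI01 I01oo be orth_cos e1 ui).
Qed.

Lemma riemann_lebesgue_sin (u : cR -> R) : mu.-integrable I01 (EFin \o u) ->
  \int[mu]_(x in I01) (u x * sin (freq k * x)) @[k --> \oo] --> (0 : R).
Proof.
move=> ui.
have be k : bounded_measurable (I01 : set cR) (fun x => sin (freq k * x)).
  by apply/continuous_bounded_measurable/smooth_continuous/smooth_sinl.
have e1 k (x : R) : I01 x -> `|sin (freq k * x)| <= 1 by move=> _; exact: sin_max.
exact: (bessel_cvg0 mI01 I01oo be orth_sin e1 ui).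
Qed.

(** * Boundary layers and oscillating test functions *)

Lemma layer_cvg0 (u : cR -> R) : mu.-integrable I01 (EFin \o u) ->
  \int[mu]_(x in I01) (`|u x| *
    \1_(~` `[(2 / n.+1%:R : R), 1 - 2 / n.+1%:R]) x) @[n --> \oo] --> (0 : R).
Proof.
move=> ui.
pose J n : set cR := `[(2 / n.+1%:R : R), 1 - 2 / n.+1%:R]%classic.
have mJ n : measurable (~` J n).
  by apply: measurableC; exact: measurable_itv_completed.
have mu01 : mu ([set (0 : R)] `|` [set (1 : R)]) = 0%E.
  transitivity (@lebesgue_measure R ([set (0 : R)] `|` [set (1 : R)])) => //.
  rewrite (@measureU0 _ _ _ (@lebesgue_measure R)).
  - exact: lebesgue_measure_set1.
  - exact: measurable_set1.
  - exact: measurable_set1.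
  - exact: lebesgue_measure_set1.
have iu := integrable_norm ui.
have mf n : measurable_fun (I01 : set cR)
    (EFin \o (fun x => `|u x| * \1_(~` J n) x)).
  apply/measurable_EFinP; apply: measurable_funM.
    by apply/measurable_EFinP; exact: measurable_int iu.
  by apply: measurable_funTS; exact/measurable_indicP.
(* Every interior point eventually leaves the shrinking layers; the two endpoints form a null set.
   Dominated convergence applies with |u| as the bound. *)
have cvg0 : {ae mu, forall x, I01 x ->
    (EFin \o (fun x => `|u x| * \1_(~` J n) x)) x @[n --> \oo] --> 0%E}.
  exists ([set (0 : R)] `|` [set (1 : R)] : set cR); split => //.
    by apply: sub_caratheodory; apply: measurableU; exact: measurable_set1.
  move=> x /= nx; apply: contrapT => x01; apply: nx.
  rewrite in_itv/= => /andP[x0 x1].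
  have {}x0 : 0 < x.
    by rewrite lt_neqAle x0 andbT; apply/eqP => x0'; apply: x01; left.
  have {}x1 : x < 1.
    by rewrite lt_neqAle x1 andbT; apply/eqP => x1'; apply: x01; right.
  apply: cvg_near_cst; near=> n.
  have xJ : J n x.
    have : n.+1%:R^-1 < Num.min x (1 - x) / 2.
      near: n; have e0 : 0 < Num.min x (1 - x) / 2.
        by rewrite divr_gt0// lt_min x0 subr_gt0.
      exact: (near_infty_natSinv_lt (PosNum e0)).
    rewrite ltr_pdivlMr// lt_min => /andP[h1 h2].
    move: h1 h2; rewrite /J/= in_itv/=; set v := _^-1 => h1 h2.
    by apply/andP; split; lra.
  by rewrite /= indicE memNset ?mulr0//; apply; exact: xJ.
have dom : {ae mu, forall (x : cR) n, I01 x ->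
    (`|(EFin \o (fun x => `|u x| * \1_(~` J n) x)%R) x| <=
     (EFin \o (fun x => `|u x|)%R) x)%E}.
  apply: aeW => x n _; rewrite /= lee_fin normrM normr_id.
  rewrite -[leRHS]mulr1 ler_wpM2l// indicE ger0_norm ?ler0n//.
  by case: (_ \in _); rewrite ?ler01.
have [_ _] := dominated_convergence mI01 mf (measurable_cst _) cvg0 iu dom.
by rewrite integral0 => /fine_cvg.
Unshelve. all: by end_near. Qed.
(** A function v vanishing where chi = 1 lives in a boundary layer, and a thin enough layer carries
    less than [eps] of the mass of every |u_i|. Finiteness of [I] allows a single chi. *)
Lemma cutoff_exists (I : finType) (u : I -> cR -> R) (eps : R) :
  (forall i, mu.-integrable I01 (EFin \o u i)) -> 0 < eps ->
  exists chi, [/\ test chi, forall x, 0 <= chi x <= 1 &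
    forall i (v : cR -> R) M, measurable_fun (I01 : set cR) v ->
      (forall x, I01 x -> `|v x| <= M) -> (forall x, chi x = 1 -> v x = 0) ->
      `|\int[mu]_(x in I01) (u i x * v x)| <= M * eps].
Proof.
move=> ui eps0.
have : \forall n \near \oo, forall i, `|\int[mu]_(x in I01) (`|u i x| *
    \1_(~` `[(2 / n.+1%:R : R), 1 - 2 / n.+1%:R]) x)| < eps.
  apply: filter_forall => i.
  by have /cvgr0Pnorm_lt/(_ _ eps0) := layer_cvg0 (ui i).
move=> /filter_ex[n]; set J := (X in ~` X) => un.
have [chi [tchi chi01 chi1]] := @test_cutoff R n.
exists chi; split=> // i v M mv vM v0.
have M0 : 0 <= M.
  by apply: le_trans (vM 0 _); rewrite //= in_itv/= lexx ler01.
have mJ : measurable (~` J : set cR).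
  by apply: measurableC; exact: measurable_itv_completed.
have iJ : mu.-integrable I01 (EFin \o (fun x : cR => `|u i x| * \1_(~` J) x)).
  apply: (@integrable_mul_bounded _ _ _ mu I01 mI01 _ _ 1).
  - exact: integrable_norm (ui i).
  - by apply: measurable_funTS; exact/measurable_indicP.
  - move=> x _; rewrite indicE ger0_norm ?ler0n//.
    by case: (_ \in _); rewrite ?ler01.
apply: (@le_trans _ _ (M * \int[mu]_(x in I01) (`|u i x| * \1_(~` J) x))).
  rewrite -RintegralZl//; apply: norm_Rintegral_le => //.
  - exact: (integrable_mul_bounded mI01 (ui i) mv vM).
  - exact: integrable_scale.
  - move=> x Ix; rewrite normrM indicE.
    have [xJ|xJ] := pselect (J x).
      rewrite v0 ?normr0 ?mulr0; first by rewrite !mulr_ge0.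
      apply: chi1; move: xJ; rewrite /J/= in_itv/= => /andP[h1 h2].
        by rewrite mulrC -ler_pdivrMr.
      by rewrite mulrC -ler_pdivrMr// lerBrDl addrC -lerBrDl.
    rewrite mem_set//= mulr1 mulrC ler_wpM2r//; exact: vM.
apply: ler_wpM2l => //; apply: le_trans (ltW (un i)).
exact: ler_norm.
Qed.

(** Take theta(x) = chi(x) freq(k) x with k large. Riemann-Lebesgue makes the integrals with the
    linear phase smaller than eps/2. Cutting off the phase changes cos and sin by at most 2, and
    only in the layer, which costs 2 (eps/4). *)
Lemma oscillating_phase (I : finType) (u : I -> cR -> R) (eps : R) :
  (forall i, mu.-integrable I01 (EFin \o u i)) -> 0 < eps ->
  exists2 theta, test theta & forall i,
    [/\ `|\int[mu]_(x in I01) (u i x * cos (theta x))| <= eps,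
        `|\int[mu]_(x in I01) (u i x * sin (theta x))| <= eps,
        `|\int[mu]_(x in I01) (u i x * cos (2 * theta x))| <= eps &
        `|\int[mu]_(x in I01) (u i x * sin (2 * theta x))| <= eps].
Proof.
move=> ui eps0.
have eps2 : 0 < eps / 2 by rewrite divr_gt0.
have eps4 : 0 < eps / 4 by rewrite divr_gt0.
have [chi [tchi chi01 chiu]] := cutoff_exists ui eps4.
pose small (g : R -> R) := forall i,
  `|\int[mu]_(x in I01) (u i x * g x)| < eps / 2.
have near_cos : \forall k \near \oo, small (fun x => cos (freq k * x)).
  apply: filter_forall => i.
  by have /cvgr0Pnorm_lt/(_ _ eps2) := riemann_lebesgue_cos (ui i).
have near_sin : \forall k \near \oo, small (fun x => sin (freq k * x)).
  apply: filter_forall => i.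
  by have /cvgr0Pnorm_lt/(_ _ eps2) := riemann_lebesgue_sin (ui i).
have near_double (P : nat -> Prop) : (\forall k \near \oo, P k) ->
    \forall k \near \oo, P k.*2.+1.
  move=> [N _ HN]; exists N => // k /= Nk; apply: HN => /=.
  by apply: leq_trans Nk _; rewrite -addnn -addnS leq_addr.
have [k [c1 s1 c2 s2]] : exists k, [/\ small (fun x => cos (freq k * x)),
    small (fun x => sin (freq k * x)),
    small (fun x => cos (freq k.*2.+1 * x)) &
    small (fun x => sin (freq k.*2.+1 * x))].
  near \oo => k; exists k; split; near: k => //.
  - exact: near_double near_cos.
  - exact: near_double near_sin.
pose theta x := chi x * (freq k * x).
have slin : smooth (fun x : R => freq k * x).
  by apply: smoothM; [exact: smooth_cst|exact: smooth_id].
have ttheta : test theta by exact: testM.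
have [stheta _ _] := ttheta.
have H (t : R -> R) i : smooth t -> (forall x, `|t x| <= 1) ->
    small (fun x => t (freq k * x)) ->
    `|\int[mu]_(x in I01) (u i x * t (theta x))| <= eps.
  move=> st t1 smallt.
  have st1 := smooth_comp st slin; have st2 := smooth_comp st stheta.
  have bm (g : R -> R) : smooth g -> measurable_fun (I01 : set cR) g.
    exact: smooth_measurable_completed.
  have iu (g : R -> R) : smooth g -> (forall x, `|g x| <= 1) ->
      mu.-integrable I01 (EFin \o (fun x => u i x * g x)).
    move=> sg g1.
    exact: (integrable_mul_bounded mI01 (ui i) (bm _ sg) (fun x _ => g1 x)).
  pose v x := t (theta x) - t (freq k * x).
  have mv : measurable_fun (I01 : set cR) v 
    by apply: measurable_funB; [exact: (bm _ st2)|exact: (bm _ st1)].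
  have v2 x : I01 x -> `|v x| <= 2.
    by move=> _; apply: le_trans (ler_normB _ _) _; rewrite -[2]/(1 + 1) lerD.
  have v0 x : chi x = 1 -> v x = 0.
    by rewrite /v /theta => ->; rewrite mul1r subrr.
  have -> : \int[mu]_(x in I01) (u i x * t (theta x)) =
      \int[mu]_(x in I01) (u i x * t (freq k * x)) +
      \int[mu]_(x in I01) (u i x * v x).
    rewrite -RintegralD//.
    - by apply: eq_Rintegral => x _; rewrite /v; ring.
    - exact: (iu _ st1 (fun x => t1 _)).
    - exact: (integrable_mul_bounded mI01 (ui i) mv v2).
  apply: le_trans (ler_normD _ _) _.
  have := chiu i v 2 mv v2 v0; have := smallt i; lra.
have s2l : smooth (fun x : R => 2 * x).
  by apply: smoothM; [exact: smooth_cst|exact: smooth_id].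
have dbl (t : R -> R) : small (fun x => t (freq k.*2.+1 * x)) ->
    small (fun x => t (2 * (freq k * x))).
  by under [in X in _ -> X]eq_fun do rewrite mulrA double_freq.
exists theta => // i; split.
- exact: (H cos i (@smooth_cos R) (@cos_max R) c1).
- exact: (H sin i (@smooth_sin R) (@sin_max R) s1).
- exact: (H _ i (smooth_comp (@smooth_cos R) s2l) (fun x => cos_max _)
    (dbl _ c2)).
- exact: (H _ i (smooth_comp (@smooth_sin R) s2l) (fun x => sin_max _)
    (dbl _ s2)).
Unshelve. all: by end_near. Qed.

(** * The case of dual test functions *)

Lemma annihilate_dual (m : nat) (f : 'I_m -> cR -> R) (phi : 'I_m -> R -> R) :
  (forall l, mu.-integrable I01 (EFin \o f l)) -> (forall k, test (phi k)) ->
  (forall l k, \int[mu]_(x in I01) (f l x * phi k x) = (l == k)%:R) ->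
  exists2 g, test g & forall l, \int[mu]_(x in I01) (f l x * cos (g x)) = 0 /\
    \int[mu]_(x in I01) (f l x * sin (g x)) = 0.
Proof.
move=> fi tphi dual.
have cphi k : continuous (phi k) by have [/smooth_continuous] := tphi k.
have mphi k : measurable_fun (I01 : set cR) (phi k).
  exact: continuous_measurable_completed.
have /choice[B HB] k : exists b, 0 < b /\ forall x, I01 x -> `|phi k x| <= b.
  by have [M M0 HM] := continuous_bounded01 (cphi k); exists M.
pose K := \sum_k B k.
have K0 : 0 <= K by apply: sumr_ge0 => k _; exact: ltW (HB k).1.
have phiK k x : I01 x -> `|phi k x| <= K.
  move=> Ix; apply: le_trans ((HB k).2 x Ix) _.
  rewrite /K (bigD1 k)//= lerDl; apply: sumr_ge0 => j _; exact: ltW (HB j).1.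
(* The boolean selects the sine or the cosine equation. The factor 2 in [q] offsets the mean 1/2 of
   cos^2 and sin^2, and the sign in [w] makes [e] exactly sin or cos, so the linear part is close to
   the identity. *)
pose I := (bool * 'I_m)%type.
pose q (i : I) (x : cR) := 2 * f i.2 x.
pose w (b : bool) (x : R) : R := if b then sin x else - cos x.
pose e (b : bool) (x : R) : R := if b then cos x else sin x.
have qi i : mu.-integrable I01 (EFin \o q i) by exact: integrable_scale.
have dw b (z : R) : is_derive z 1 (w b) (e b z).
  case: b; first exact: is_derive_sin.
  have := is_deriveN (is_derive_cos z); by rewrite opprK.
have e1 b z : `|e b z| <= 1 by case: b; [exact: cos_max|exact: sin_max].
have w1 b z : `|w b z| <= 1.
  by case: b; rewrite /w ?normrN; [exact: sin_max|exact: cos_max].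
have se b : smooth (e b) by case: b; [exact: smooth_cos|exact: smooth_sin].
have eL b x y : `|e b x - e b y| <= `|x - y|.
  case: b.
    apply: (lipschitz1 x y (@is_derive_cos R)) => z.
    by rewrite normrN; exact: sin_max.
  exact: (lipschitz1 x y (@is_derive_sin R) (@cos_max R)).
have [eps eps0 correct] := @phase_correction _ _ R mu I01 mI01 I q
  (fun i => w i.1) (fun i => e i.1) K qi (fun i => dw i.1) (fun i => eL i.1)
  (fun i => w1 i.1) (fun i => e1 i.1) K0.
(* The f_l enter the values at the unperturbed phase, through theta; the products f_l phi_k enter
   the linear part, through 2 theta. *)
pose u (s : 'I_m + 'I_m * 'I_m) (x : cR) :=
  match s with inl l => f l x | inr (l, k) => f l x * phi k x end.
have ui s : mu.-integrable I01 (EFin \o u s).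
  case: s => [l|[l k]]; first exact: fi.
  exact: (integrable_mul_bounded mI01 (fi l) (mphi k) (phiK k)).
(* Halving [eps] absorbs the factor 2 of [q]. *)
have eps2 : 0 < eps / 2 by rewrite divr_gt0.
have [theta ttheta small] := oscillating_phase ui eps2.
have [stheta _ _] := ttheta.
have smooth_etheta b : smooth (fun x => e b (theta x)).
  exact: (smooth_comp (se b) stheta).
have mg (g : R -> R) : smooth g -> measurable_fun (I01 : set cR) g.
  exact: smooth_measurable_completed.
pose psi (j : I) x := phi j.2 x * e j.1 (theta x).
have tpsi j : test (psi j) by exact: testM (tphi j.2) (smooth_etheta j.1).
have mtheta : measurable_fun (I01 : set cR) theta by exact: mg.
have mpsi j : measurable_fun (I01 : set cR) (psi j).
  by apply: mg; case: (tpsi j).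
have psiK j x : I01 x -> `|psi j x| <= K.
  by move=> Ix; rewrite normrM -[K]mulr1 ler_pM// phiK.
have [||c Hc] := correct psi theta mpsi mtheta psiK.
- move=> [b l] /=; have [hc hs _ _] := small (inl l); rewrite /= in hc hs.
  have -> : \int[mu]_(x in I01) (q (b, l) x * w b (theta x)) =
      \int[mu]_(x in I01) ((if b then 2 else -2) * (f l x * e (~~ b) (theta x))).
    by apply: eq_Rintegral => x _; rewrite /q /w /e /=; case: b => /=; ring.
  rewrite RintegralZl//; last first.
    exact: (integrable_mul_bounded mI01 (fi l) (mg _ (smooth_etheta (~~ b)))
      (fun x _ => e1 (~~ b) (theta x))).
  rewrite normrM.
  have -> : `|if b then 2 else -2| = 2 :> R.
    by case: b; rewrite ?normrN ger0_norm.
  by rewrite mulrC -ler_pdivlMr//; case: b.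
- move=> [b l] [b' k] /=.
  have [_ _ hc hs] := small (inr (l, k)); rewrite /= in hc hs.
  (* By the double-angle formulas this is 2 e_b e_b' at theta, minus 1 if b = b'. The subtracted
     constant integrates, by duality, to the Kronecker delta. *)
  pose E x : R := match b, b' with
    | true, true => cos (2 * theta x) | false, false => - cos (2 * theta x)
    | _, _ => sin (2 * theta x) end.
  have iphi := ui (inr (l, k)).
  have s2 : smooth (fun x => 2 * theta x).
    exact: (smoothM (@smooth_cst R 2) stheta).
  have ms2 : measurable_fun (I01 : set cR) (fun x => sin (2 * theta x)).
    exact: mg (smooth_comp (@smooth_sin R) s2).
  have mc2 : measurable_fun (I01 : set cR) (fun x => cos (2 * theta x)).
    exact: mg (smooth_comp (@smooth_cos R) s2).
  have is2 := integrable_mul_bounded mI01 iphi ms2 (fun x _ => sin_max (2 * theta x)).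
  have ic2 := integrable_mul_bounded mI01 iphi mc2 (fun x _ => cos_max (2 * theta x)).
  have [iE IE] : mu.-integrable I01 (EFin \o (fun x => f l x * phi k x * E x)) /\
      `|\int[mu]_(x in I01) (f l x * phi k x * E x)| <= eps / 2.
    rewrite /E {E}; case: b; case: b'; split => //.
      apply: eq_integrable (integrable_scale mI01 (-1) ic2) => // x _ /=.
      by rewrite mulN1r mulrN.
    rewrite (_ : Rintegral _ _ _ = \int[mu]_(x in I01)
        (-1 * (f l x * phi k x * cos (2 * theta x)))); last first.
      by apply: eq_Rintegral => x _; rewrite mulN1r mulrN.
    by rewrite RintegralZl// mulN1r normrN.
  have -> : \int[mu]_(x in I01) (q (b, l) x * (e b (theta x) * psi (b', k) x))
      = (b == b')%:R * (l == k)%:R +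
        \int[mu]_(x in I01) (f l x * phi k x * E x).
    rewrite -dual -RintegralZl// -RintegralD//; last exact: integrable_scale.
    apply: eq_Rintegral => x _; rewrite /q /psi /E /e /= {iE IE E}.
    have c2 : cos (2 * theta x) = 2 * cos (theta x) ^+ 2 - 1.
      by rewrite mulr_natl cos_mulr2n mulr_natl.
    have c2' : cos (2 * theta x) = 1 - 2 * sin (theta x) ^+ 2.
      by rewrite c2 cos2sin2; ring.
    have s2x : sin (2 * theta x) = 2 * (sin (theta x) * cos (theta x)).
      by rewrite mulr_natl sin_mulr2n -mulr_natl (mulrC (cos _)).
    by case: b; case: b' => /=; rewrite ?s2x; [rewrite c2| | |rewrite c2']; ring.
  rewrite xpair_eqE -mulnb natrM addrAC subrr add0r.
  apply: le_trans IE _; apply: ler_piMr; first exact: ltW.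
  by rewrite invf_le1 ?ler1n.
pose g x := theta x + \sum_j c j * psi j x.
have tg : test g.
  apply: (testD ttheta); apply: test_sum => j.
  rewrite (_ : (fun x => _) = fun x => psi j x * c j); last first.
    by apply/funext => x; rewrite mulrC.
  by apply: testM; [exact: tpsi|exact: smooth_cst].
have sg : smooth g by case: tg.
exists g => // l.
have ib b := integrable_mul_bounded mI01 (fi l)
  (mg _ (smooth_comp (se b) sg)) (fun x _ => e1 b (g x)).
split.
- have := Hc (false, l); rewrite /q /w /=.
  rewrite (_ : Rintegral _ _ _ = \int[mu]_(x in I01)
      (-2 * (f l x * cos (g x)))); last first.
    by apply: eq_Rintegral => x _; rewrite -/(g x); ring.
  rewrite RintegralZl//; last exact: (ib true).
  by move/eqP; rewrite mulf_eq0 oppr_eq0 pnatr_eq0/= => /eqP.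
- have := Hc (true, l); rewrite /q /w /=.
  rewrite (_ : Rintegral _ _ _ = \int[mu]_(x in I01)
      (2 * (f l x * sin (g x)))); last first.
    by apply: eq_Rintegral => x _; rewrite -/(g x); ring.
  rewrite RintegralZl//; last exact: (ib false).
  by move/eqP; rewrite mulf_eq0 pnatr_eq0/= => /eqP.
Qed.

(** * Reduction to the dual case through moment vectors *)

Let mg (g : R -> R) : smooth g -> measurable_fun (I01 : set cR) g.
Proof. exact: smooth_measurable_completed. Qed.

(** The function chi h is a test function, and (1 - chi) h contributes at most [eps] for a suitable
    cutoff chi. This reaches cos g, which is 1 wherever g vanishes and hence is not a test
    function. *)
Lemma annihilator_smooth (u : cR -> R) : mu.-integrable I01 (EFin \o u) ->
  (forall phi, test phi -> \int[mu]_(x in I01) (u x * phi x) = 0) ->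
  forall h : R -> R, smooth h -> (forall x, `|h x| <= 1) ->
  \int[mu]_(x in I01) (u x * h x) = 0.
Proof.
move=> ui u0 h sh h1; apply/eqP; rewrite -normr_le0; apply/ler_addgt0Pl => eps eps0.
rewrite addr0.
have [chi [tchi chi01 chiu]] := @cutoff_exists unit (fun=> u) eps (fun=> ui) eps0.
have tch := testM tchi sh; have [sch _ _] := tch.
pose v x := h x - chi x * h x.
have mv : measurable_fun (I01 : set cR) v.
  by apply: measurable_funB; [exact: (mg sh)|exact: (mg sch)].
have v1 x : I01 x -> `|v x| <= 1.
  move=> _; rewrite /v -[X in X - _]mul1r -mulrBl normrM.
  have /andP[c0 c1] := chi01 x.
  by rewrite -[leRHS]mulr1 ler_pM// ger0_norm ?subr_ge0// lerBlDr lerDl.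
have v0 x : chi x = 1 -> v x = 0 by rewrite /v => ->; rewrite mul1r subrr.
have ich : mu.-integrable I01 (EFin \o (fun x : cR => u x * (chi x * h x))).
  apply: (integrable_mul_bounded mI01 ui (mg sch) (M := 1)) => x _.
  have /andP[c0 c1] := chi01 x.
  by rewrite normrM -[1]mulr1 ler_pM// ger0_norm.
have := chiu tt v 1 mv v1 v0; rewrite mul1r.
have -> : \int[mu]_(x in I01) (u x * h x) = \int[mu]_(x in I01) (u x * v x)
    + \int[mu]_(x in I01) (u x * (chi x * h x)).
  rewrite -RintegralD//; last exact: (integrable_mul_bounded mI01 ui mv v1).
  by apply: eq_Rintegral => x _; rewrite /v; ring.
by rewrite (u0 _ tch) addr0.
Qed.

Variables (n : nat) (f : 'I_n -> cR -> R).
Hypothesis fi : forall j, mu.-integrable I01 (EFin \o f j).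

Definition moments (h : R -> R) : 'rV[R]_n :=
  \row_j \int[mu]_(x in I01) (f j x * h x).

Lemma moments_mulmx m (B : 'M[R]_(n, m)) (h : R -> R) (M : R) : smooth h ->
  (forall x, I01 x -> `|h x| <= M) -> forall l,
  (moments h *m B) 0 l = \int[mu]_(x in I01) ((\sum_j B j l * f j x) * h x).
Proof.
move=> sh hM l; rewrite mxE.
have ih j := integrable_mul_bounded mI01 (fi j) (mg sh) hM.
transitivity (\int[mu]_(x in I01) (\sum_j B j l * (f j x * h x))).
  rewrite Rintegral_sum//; last by move=> j; exact: integrable_scale (ih j).
  by apply: eq_bigr => j _; rewrite mxE RintegralZl// mulrC.
apply: eq_Rintegral => x _; rewrite mulr_suml.
by apply: eq_bigr => j _; rewrite mulrA.
Qed.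

Lemma test_bounded phi : test phi ->
  exists M, forall x, I01 x -> `|phi x| <= M.
Proof.
by move=> [/smooth_continuous cphi _ _];
  have [M _ HM] := continuous_bounded01 cphi; exists M.
Qed.

(** A linearly independent family of moment vectors has at most n members, so one of maximal size
    exists. A test function with moments outside its span could be added to it. *)
Lemma moments_basis : exists r (phi : 'I_r -> R -> R),
  [/\ forall k, test (phi k), row_free (\matrix_k moments (phi k)) &
    forall psi, test psi -> (moments psi <= \matrix_k moments (phi k))%MS].
Proof.
pose P r := `[< exists phi : 'I_r -> R -> R,
  (forall k, test (phi k)) /\ row_free (\matrix_k moments (phi k)) >].
have P0 : exists r, P r.
  exists 0%N; apply/asboolP; exists (fun=> 0); split; first by case.
  by rewrite /row_free -leqn0 rank_leq_row.
have Pn r : P r -> (r <= n)%N.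
  by move=> /asboolP[phi [_ /eqP <-]]; exact: rank_leq_col.
have [r /asboolP[phi [tphi free]] rmax] := ex_maxnP P0 Pn.
exists r, phi; split => // psi tpsi; apply: contrapT => /negP npsi.
suff /rmax : P r.+1 by rewrite ltnn.
apply/asboolP; exists (fun k => if unlift ord0 k is Some k' then phi k' else psi).
split; first by move=> k; case: unliftP => [k' _|_].
set A := \matrix_k moments (phi k) in free npsi *.
set A' := (X in row_free X).
have sub1 : (A <= A')%MS.
  apply/row_subP => k; rewrite rowK.
  have -> : moments (phi k) = row (lift ord0 k) A' by rewrite rowK liftK.
  exact: row_sub.
have sub2 : (moments psi <= A')%MS.
  have -> : moments psi = row ord0 A' by rewrite rowK unlift_none.
  exact: row_sub.
have lt : (A < A')%MS.
  rewrite ltmxE sub1/=; apply: contra npsi; exact: submx_trans.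
rewrite /row_free eqn_leq rank_leq_row/=.
by move: (rank_ltmx lt); rewrite (eqP free).
Qed.

Lemma annihilating_phase : exists2 g, test g &
  moments (fun x => cos (g x)) = 0 /\ moments (fun x => sin (g x)) = 0.
Proof.
have [r [phi [tphi free span]]] := moments_basis.
set A := \matrix_k _ in free span.
(* The columns of this right inverse of [A] give the combinations [ft] of the f_j that are dual to
   the phi_k. *)
pose B := pinvmx A.
have AB : A *m B = 1%:M by exact: mulmxVp.
pose ft (l : 'I_r) (x : cR) := \sum_j B j l * f j x.
have fti l : mu.-integrable I01 (EFin \o ft l).
  by apply: integrable_fsum => // j; exact: integrable_scale (fi j).
have dual l k : \int[mu]_(x in I01) (ft l x * phi k x) = (l == k)%:R.
  have [M HM] := test_bounded (tphi k); have [sphi _ _] := tphi k.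
  rewrite -(moments_mulmx B sphi HM) -[moments _](rowK (fun k => moments (phi k))).
  by rewrite -row_mul AB !mxE eq_sym.
have [g tg gft] := annihilate_dual fti tphi dual.
have [sg _ _] := tg.
have key (h : R -> R) : smooth h -> (forall x, `|h x| <= 1) ->
    (forall l, \int[mu]_(x in I01) (ft l x * h x) = 0) -> moments h = 0.
  move=> sh h1 hft.
  have hB : moments h *m B = 0.
    by apply/rowP => l; rewrite (moments_mulmx B sh (fun x _ => h1 x)) hft mxE.
  (* Each column of the cokernel of [A] gives a combination of the f_j whose integral against every
     test function is 0, hence also against h. *)
  have : (moments h <= A)%MS.
    rewrite submxE; apply/eqP/rowP => l.
    rewrite (moments_mulmx _ sh (fun x _ => h1 x)) mxE.
    apply: annihilator_smooth => // [|psi tpsi].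
      by apply: integrable_fsum => // j; exact: integrable_scale (fi j).
    have [M HM] := test_bounded tpsi; have [spsi _ _] := tpsi.
    rewrite -(moments_mulmx _ spsi HM).
    by have := span _ tpsi; rewrite submxE => /eqP ->; rewrite mxE.
  (* On the row space of [A], multiplication by [B] is injective: C A B = C, so a vector C A killed
     by [B] is 0. *)
  move=> /submxP[C hC].
  by rewrite hC -[C]mulmx1 -AB mulmxA -hC hB mul0mx.
exists g => //; split.
- apply: key.
  + exact: (smooth_comp (@smooth_cos R) sg).
  + by move=> x; exact: cos_max.
  + by move=> l; exact: (gft l).1.
- apply: key.
  + exact: (smooth_comp (@smooth_sin R) sg).
  + by move=> x; exact: sin_max.
  + by move=> l; exact: (gft l).2.
Qed.

End completed_lebesgue.

Unset Implicit Arguments.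
Set Strict Implicit.
Set Printing Implicit Defensive.

Theorem theorem1p1 (R : realType) (n : nat) (hn : (1 <= n)%N)
    (f : 'I_n -> R -> R) (hf : forall j, L1_01 (f j)) :
  exists g : R -> R,
    smooth_compact_support `]0, 1[ g /\
    forall j : 'I_n,
      Cintegral (@completed_lebesgue_measure R) `[0, 1]
        (fun x => (f j x)%:C%C * expC ('i%C * (g x)%:C%C)) = 0.
Proof.
have [g tg [gc gs]] := annihilating_phase hf.
exists g; split => // j.
(* Since i g(x) is purely imaginary, the modulus of the exponential is exp 0 = 1, and the two
   components are the cosine and sine moments. *)
have E (x : R) : (f j x)%:C%C * expC ('i%C * (g x)%:C%C) =
    (f j x * cos (g x) +i* (f j x * sin (g x)))%C.
  rewrite /expC /=; simpc.
  by rewrite expR0 !mul1r.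
rewrite /Cintegral -[RHS]/(0 +i* 0)%C; congr (_ +i* _)%C.
- have := congr1 (fun M : 'rV[R]_n => M ord0 j) gc; rewrite !mxE; apply: etrans.
  by apply: eq_Rintegral => x _; rewrite E.
- have := congr1 (fun M : 'rV[R]_n => M ord0 j) gs; rewrite !mxE; apply: etrans.
  by apply: eq_Rintegral => x _; rewrite E.
Qed.
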